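(* Let $(X,r)$ be a 2-cancellative quadratic set, and let $S=S(X,r)$ be the associated monoid, graded by length. Then $S$ is a graded braided monoid $(S,r_S)$ reducing to $(X,r)$ on degree one (i.e. $S$ carries a graded braided monoid structure whose map $r_S$ restricts to $r$ on $X\times X$) if and only if $(X,r)$ is a braided set.
   Context: A quadratic set $(X,r)$ is a nonempty set $X$ with a bijective map $r:X\times X\to X\times X$, $r(x,y)=({}^xy,x^y)$. It is a braided set if $r^{12}r^{23}r^{12}=r^{23}r^{12}r^{23}$ on $X^3$ (the Yang-Baxter equation, YBE), where $r^{12}=r\times\mathrm{id}$, $r^{23}=\mathrm{id}\times r$. It is 2-cancellative if for every positive integer $k$ less than the order of $r$ (possibly infinite): $r^k(x,y)=(x,z)$ implies $z=y$, and $r^k(x,y)=(t,y)$ implies $x=t$. The associated monoid $S(X,r)$ is generated by $X$ with defining relations $xy=zt$ whenever $r(x,y)=(z,t)$; it is graded by length with degree-one part $X$. An $\mathbf{M3}$-monoid is a monoid $S$ with maps $(u,v)\mapsto{}^uv$ and $(u,v)\mapsto u^v$ from $S\times S$ to $S$ such that for all $a,b,u,v\in S$: ${}^a1=1$, ${}^1u=u$, $1^u=1$, $a^1=a$; ${}^{ab}u={}^a({}^bu)$, $a^{uv}=(a^u)^v$; ${}^a(uv)=({}^au)({}^{a^u}v)$, $(ab)^u=(a^{{}^bu})(b^u)$; and ${}^uv\,u^v=uv$. Its associated map is $r_S(u,v)=({}^uv,u^v)$. It is graded if $S$ is graded by length, generated in degree one, and the actions preserve length. A braided monoid is an $\mathbf{M3}$-monoid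 for which $r_S$ is bijective and obeys the YBE. *)

(* Defs.v *)
From HB Require Import structures.
From mathcomp Require Import all_boot.
From mathcomp Require Import boolp.
Set Implicit Arguments.
Unset Strict Implicit.
Unset Printing Implicit Defensive.

Section QuadraticSets.
Local Open Scope quotient_scope.
Variables (X : Type) (r : X * X -> X * X).

Definition quadratic_set : Prop := inhabited X /\ bijective r.

Definition r12 (p : X * X * X) : X * X * X := (r p.1, p.2).
Definition r23 (p : X * X * X) : X * X * X :=
  let q := r (p.1.2, p.2) in (p.1.1, q.1, q.2).

Definition yang_baxter : Prop := r12 \o r23 \o r12 =1 r23 \o r12 \o r23.

Definition braided_set : Prop := quadratic_set /\ yang_baxter.

(* The order of r is the infimum of { n > 0 | r^n = id }, infinite when this
   set is empty; k is below it iff k is below every element of the set. *)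
Definition below_order (k : nat) : Prop :=
  forall n, 0 < n -> iter n r =1 id -> k < n.

Definition two_cancellative : Prop :=
  forall k, 0 < k -> below_order k ->
    (forall x y z, iter k r (x, y) = (x, z) -> z = y) /\
    (forall x y t, iter k r (x, y) = (t, y) -> x = t).

Inductive word_cong : seq X -> seq X -> Prop :=
| word_cong_rel x y z t : r (x, y) = (z, t) -> word_cong [:: x; y] [:: z; t]
| word_cong_refl u : word_cong u u
| word_cong_sym u v : word_cong u v -> word_cong v u
| word_cong_trans u v w : word_cong u v -> word_cong v w -> word_cong u w
| word_cong_cat u u' v v' :
    word_cong u u' -> word_cong v v' -> word_cong (u ++ v) (u' ++ v').

Lemma word_cong_size u v : word_cong u v -> size u = size v.
Proof.
elim=> // [u1 v1 w1 _ -> _ -> // | u1 u2 v1 v2 _ e1 _ e2].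
by rewrite !size_cat e1 e2.
Qed.

Lemma word_cong_short u v : word_cong u v -> size u <= 1 -> u = v.
Proof.
elim=> // {u v} [u v cuv IH sv | u v w cuv IHu _ IHv su | u u' v v' _ IHu _ IHv].
- by rewrite IH // (word_cong_size cuv).
- by rewrite (IHu su) IHv // -(word_cong_size cuv).
- rewrite size_cat => suv; rewrite IHu; last exact: leq_trans (leq_addr _ _) suv.
  by rewrite IHv //; exact: leq_trans (leq_addl _ _) suv.
Qed.

(* {classic X} is X with the classical choiceType structure required by
   {eq_quot _}. *)
Definition word_congb : rel (seq {classic X}) := fun u v => `[< word_cong u v >].

Lemma word_congb_equiv : equiv_class_of word_congb.
Proof.
split=> [u | u v | v u w]; rewrite /word_congb.
- by apply/asboolP; exact: word_cong_refl.
- by apply: asbool_equiv_eq; split; exact: word_cong_sym.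
- move=> /asboolP h1 /asboolP h2; apply/asboolP; exact: word_cong_trans h1 h2.
Qed.

Canonical word_congb_equiv_rel := EquivRelPack word_congb_equiv.

Definition assoc_monoid : Type := {eq_quot word_congb_equiv_rel}.
HB.instance Definition _ := Choice.on assoc_monoid.

Definition word_class (w : seq X) : assoc_monoid :=
  \pi_({eq_quot word_congb_equiv_rel}) (w : seq {classic X}).

Definition word_repr (u : assoc_monoid) : seq X :=
  repr (u : {eq_quot word_congb_equiv_rel}).

Lemma word_reprK : cancel word_repr word_class.
Proof. by move=> u; rewrite /word_class /word_repr reprK. Qed.

Lemma word_classP u v : word_class u = word_class v <-> word_cong u v.
Proof.
split=> [/eqP | /asboolP h]; first by rewrite /word_class eqmodE => /asboolP.
by apply/eqP; rewrite /word_class eqmodE.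
Qed.

Lemma word_class_repr w : word_cong (word_repr (word_class w)) w.
Proof. by apply/word_classP; rewrite word_reprK. Qed.

Definition assoc_mul (u v : assoc_monoid) : assoc_monoid :=
  word_class (word_repr u ++ word_repr v).

Lemma word_class_cat u v :
  word_class (u ++ v) = assoc_mul (word_class u) (word_class v).
Proof.
apply/word_classP/word_cong_sym.
by apply: word_cong_cat; exact: word_class_repr.
Qed.

Lemma assoc_mulA : associative assoc_mul.
Proof.
move=> u v w; rewrite -(word_reprK u) -(word_reprK v) -(word_reprK w).
by rewrite -!word_class_cat catA.
Qed.

Lemma assoc_mul1 : left_id (word_class [::]) assoc_mul.
Proof. by move=> u; rewrite -(word_reprK u) -word_class_cat. Qed.

Lemma assoc_mulr1 : right_id (word_class [::]) assoc_mul.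
Proof. by move=> u; rewrite -(word_reprK u) -word_class_cat cats0. Qed.

HB.instance Definition _ := isMonoid.Build assoc_monoid
  assoc_mulA assoc_mul1 assoc_mulr1.

Definition assoc_gen (x : X) : assoc_monoid := word_class [:: x].

Definition assoc_deg (u : assoc_monoid) : nat := size (word_repr u).

Lemma assoc_deg_class w : assoc_deg (word_class w) = size w.
Proof. exact/word_cong_size/word_class_repr. Qed.

Lemma assoc_gen_inj : injective assoc_gen.
Proof. by move=> x y /word_classP /word_cong_short -/(_ isT) []. Qed.

Lemma assoc_deg1P u : assoc_deg u = 1 <-> exists x, u = assoc_gen x.
Proof.
split=> [| [x ->]]; last exact: assoc_deg_class.
rewrite /assoc_deg -{2}(word_reprK u).
by case: (word_repr u) => [| x []] // _; exists x.
Qed.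

End QuadraticSets.

Section M3Monoids.
Local Open Scope group_scope.
(* [lact a u] is {}^a u and [ract a u] is a^u. *)
Variables (S : monoidType) (lact ract : S -> S -> S).

Record M3_monoid : Prop := {
  lact1 : forall a, lact a 1 = 1;
  lact1l : forall u, lact 1 u = u;
  ract1 : forall u, ract 1 u = 1;
  ract1r : forall a, ract a 1 = a;
  lactM : forall a b u, lact (a * b) u = lact a (lact b u);
  ractM : forall a u v, ract a (u * v) = ract (ract a u) v;
  lact_mul : forall a u v, lact a (u * v) = lact a u * lact (ract a u) v;
  ract_mul : forall a b u, ract (a * b) u = ract a (lact b u) * ract b u;
  braided_comm : forall u v, lact u v * ract u v = u * v
}.

Definition assoc_map (p : S * S) : S * S := (lact p.1 p.2, ract p.1 p.2).

Definition braided_monoid : Prop :=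
  M3_monoid /\ bijective assoc_map /\ yang_baxter assoc_map.

Record graded_by (deg : S -> nat) : Prop := {
  graded1 : deg 1 = 0%N;
  gradedM : forall u v, deg (u * v) = (deg u + deg v)%N;
  graded_gen : forall u, exists s : seq S,
    all (fun v => deg v == 1%N) s /\ u = \prod_(v <- s) v
}.

Definition graded_braided_monoid (deg : S -> nat) : Prop :=
  braided_monoid /\ graded_by deg /\
  (forall a u, deg (lact a u) = deg u) /\ (forall a u, deg (ract a u) = deg a).

End M3Monoids.

Lemma assoc_monoid_graded (X : Type) (r : X * X -> X * X) :
  graded_by (@assoc_deg X r).
Proof.
split=> [|u v|u]; first exact: assoc_deg_class.
  by rewrite /assoc_deg (word_cong_size (word_class_repr _ _)) size_cat.
rewrite -(word_reprK u); elim: (word_repr u) => [|x w [s [ds es]]].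
  by exists [::]; split; rewrite ?big_nil.
exists (assoc_gen r x :: s); split; first by rewrite /= assoc_deg_class.
by rewrite big_cons -es -(cat1s x w) word_class_cat.
Qed.

(* Main.v *)
(** The letterwise braiding of [X] extends to words by moving letters past one
    another one at a time.  The Yang-Baxter equation on [X] says exactly that
    each defining relation [xy = zt] of [S] is respected: acting by either side
    of it gives literally the same word, and acting on it gives the two sides of
    another defining relation.  So both actions descend to [S], and since
    [uv = (^uv)(u^v)] in [S], two of the three components of the Yang-Baxter
    equation for [r_S] are instances of this invariance; the middle one
    propagates from letters to words by concatenation.  The inverse of [r_S] is
    the extension of [r^-1], which is again braided and presents the same
    monoid.  Conversely [X] embeds in [S] as its degree one part, so that [r]
    inherits the Yang-Baxter equation from [r_S]. *)
Require Import Defs.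
From mathcomp Require Import all_boot.
From mathcomp Require Import boolp.
Set Implicit Arguments.
Unset Strict Implicit.
Unset Printing Implicit Defensive.

(** * Mutual actions of words over [X], and the Yang-Baxter equation for them *)

Section WordActions.
Variables (X : Type) (r : X * X -> X * X).

Definition lletter (x y : X) : X := (r (x, y)).1.
Definition rletter (x y : X) : X := (r (x, y)).2.

Fixpoint lletterw (x : X) (w : seq X) : seq X :=
  if w is y :: w' then lletter x y :: lletterw (rletter x y) w' else [::].
Definition rletterw (x : X) (w : seq X) : X := foldl rletter x w.

(** The last letter of [u] crosses [w] first, so each letter of [u] meets [w] as already changed by
    the letters to its right. *)
Definition lactw (u w : seq X) : seq X := foldr lletterw w u.
Fixpoint ractw (u w : seq X) : seq X :=
  if u is x :: u' then rletterw x (lactw u' w) :: ractw u' w else [::].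

Lemma lletterw_cat x v w :
  lletterw x (v ++ w) = lletterw x v ++ lletterw (rletterw x v) w.
Proof. by elim: v x => //= y v IH x; rewrite IH. Qed.

Lemma lactw_nil u : lactw u [::] = [::].
Proof. by elim: u => //= x u ->. Qed.

Lemma ractw_nil u : ractw u [::] = u.
Proof. by elim: u => //= x u ->; rewrite lactw_nil. Qed.

Lemma lactw_catl u v w : lactw (u ++ v) w = lactw u (lactw v w).
Proof. exact: foldr_cat. Qed.

Lemma ractw_catl u v w : ractw (u ++ v) w = ractw u (lactw v w) ++ ractw v w.
Proof. by elim: u => //= x u ->; rewrite lactw_catl. Qed.

Lemma lactw_catr u v w : lactw u (v ++ w) = lactw u v ++ lactw (ractw u v) w.
Proof. by elim: u => //= x u ->; rewrite lletterw_cat. Qed.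

Lemma ractw_catr u v w : ractw u (v ++ w) = ractw (ractw u v) w.
Proof.
by elim: u => //= x u ->; rewrite lactw_catr /rletterw foldl_cat.
Qed.

Lemma size_lactw u w : size (lactw u w) = size w.
Proof.
have sz1 x v : size (lletterw x v) = size v.
  by elim: v x => //= y v IH x; rewrite IH.
by elim: u => //= x u IH; rewrite sz1.
Qed.

Lemma size_ractw u w : size (ractw u w) = size u.
Proof. by elim: u => //= x u ->. Qed.

Lemma word_cong_letters x y : word_cong r [:: x; y] [:: lletter x y; rletter x y].
Proof. by apply: word_cong_rel; rewrite /lletter /rletter; case: (r _). Qed.

Lemma lactw_ractw_cong u v : word_cong r (u ++ v) (lactw u v ++ ractw u v).
Proof.
have step x w : word_cong r (x :: w) (lletterw x w ++ [:: rletterw x w]).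
  elim: w x => [|y w IH] x /=; first exact: word_cong_refl.
  apply: (@word_cong_trans _ _ _ (lletter x y :: rletter x y :: w)).
    rewrite -[x :: _]/([:: x; y] ++ w) -[lletter x y :: _]/([:: _; _] ++ w).
    by apply: word_cong_cat; [exact: word_cong_letters | exact: word_cong_refl].
  rewrite -(cat1s _ (_ :: w)) -(cat1s _ (_ ++ _)).
  by apply: word_cong_cat; [exact: word_cong_refl | exact: IH].
elim: u => [|x u IH] /=; first by rewrite cats0; exact: word_cong_refl.
apply: (@word_cong_trans _ _ _ ((x :: lactw u v) ++ ractw u v)).
  rewrite -cat1s -(cat1s x (lactw u v)) -catA.
  by apply: word_cong_cat; [exact: word_cong_refl | exact: IH].
rewrite -(cat1s (rletterw _ _)) catA.
by apply: word_cong_cat; [exact: step | exact: word_cong_refl].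
Qed.

Hypothesis ybe : yang_baxter r.

Lemma ybe_lletter x y z :
  lletter (lletter x y) (lletter (rletter x y) z) = lletter x (lletter y z).
Proof. by have /(congr1 (fun p => p.1.1)) := ybe (x, y, z). Qed.

Lemma ybe_middle x y z :
  rletter (lletter x y) (lletter (rletter x y) z) =
  lletter (rletter x (lletter y z)) (rletter y z).
Proof. by have /(congr1 (fun p => p.1.2)) := ybe (x, y, z). Qed.

Lemma ybe_rletter x y z :
  rletter (rletter x y) z = rletter (rletter x (lletter y z)) (rletter y z).
Proof. by have /(congr1 snd) := ybe (x, y, z). Qed.

(** Once the first letter [z] of [w] has crossed, the Yang-Baxter equation equates the letters
    emitted and shows that the remaining pair is again [lletter p q], [rletter p q], with
    [p = rletter x (lletter y z)] and [q = rletter y z]; induction continues with [p] and [q]. *)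
Lemma lletterw_letters x y w :
  [/\ lletterw (lletter x y) (lletterw (rletter x y) w) =
        lletterw x (lletterw y w),
      rletterw (lletter x y) (lletterw (rletter x y) w) =
        lletter (rletterw x (lletterw y w)) (rletterw y w)
    & rletterw (rletter x y) w =
        rletter (rletterw x (lletterw y w)) (rletterw y w)].
Proof.
elim: w x y => //= z w IH x y.
rewrite ybe_lletter ybe_middle ybe_rletter.
by case: (IH (rletter x (lletter y z)) (rletter y z)) => -> -> ->.
Qed.

Lemma actw_letters u x y : exists p q,
  [/\ lactw u [:: x; y] = [:: p; q],
      lactw u [:: lletter x y; rletter x y] = [:: lletter p q; rletter p q]
    & ractw u [:: x; y] = ractw u [:: lletter x y; rletter x y]].
Proof.
elim: u => [|c u [p [q [e1 e2 e3]]]] /=; first by exists x, y.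
(* The new pair is the image of the word [p q] under the letter [c]. *)
exists (lletter c p), (lletter (rletter c p) q); rewrite e1 e2 e3 /=.
by rewrite -ybe_lletter -ybe_middle -ybe_rletter.
Qed.

(** The left action gives equal words, not just congruent ones; in the concatenation case this makes
    [u] and [u'] act on the same word, so the induction hypotheses combine. *)
Lemma actw_congl u u' w : word_cong r u u' ->
  lactw u w = lactw u' w /\ word_cong r (ractw u w) (ractw u' w).
Proof.
move=> cuu; elim: cuu w => {u u'} [x y z t e|u|u v _ IH|u v v' _ IHu _ IHv
  |u u' v v' _ IHu _ IHv] w.
- have [-> ->] : z = lletter x y /\ t = rletter x y by rewrite /lletter /rletter e.
  rewrite /=; have [-> -> ->] := lletterw_letters x y w; split=> //.
  exact: word_cong_letters.
- by split=> //; exact: word_cong_refl.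
- by have [-> ?] := IH w; split=> //; exact: word_cong_sym.
- have [-> c1] := IHu w; have [-> c2] := IHv w.
  by split=> //; exact: word_cong_trans c1 c2.
- rewrite !lactw_catl !ractw_catl; have [-> c2] := IHv w.
  by have [-> c1] := IHu (lactw v' w); split=> //; exact: word_cong_cat.
Qed.

Lemma actw_congr u w w' : word_cong r w w' ->
  word_cong r (lactw u w) (lactw u w') /\ ractw u w = ractw u w'.
Proof.
move=> cww; elim: cww u => {w w'} [x y z t e|w|w v _ IH|w v v' _ IHw _ IHv
  |w w' v v' _ IHw _ IHv] u.
- have [-> ->] : z = lletter x y /\ t = rletter x y by rewrite /lletter /rletter e.
  have [p [q [-> -> ->]]] := actw_letters u x y; split=> //.
  exact: word_cong_letters.
- by split=> //; exact: word_cong_refl.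
- by have [? ->] := IH u; split=> //; exact: word_cong_sym.
- have [c1 ->] := IHw u; have [c2 ->] := IHv u.
  by split=> //; exact: word_cong_trans c1 c2.
- rewrite !lactw_catr !ractw_catr; have [c1 ->] := IHw u.
  by have [c2 ->] := IHv (ractw u w'); split=> //; exact: word_cong_cat.
Qed.

Lemma actw_cong u u' w w' : word_cong r u u' -> word_cong r w w' ->
  word_cong r (lactw u w) (lactw u' w') /\ word_cong r (ractw u w) (ractw u' w').
Proof.
move=> cu cw; have [-> c] := actw_congl w cu.
by have [c' <-] := actw_congr u' cw.
Qed.

Lemma ybe_lactw u v w : lactw (lactw u v) (lactw (ractw u v) w) = lactw u (lactw v w).
Proof.
by rewrite -!lactw_catl; case: (actw_congl w (lactw_ractw_cong u v)).
Qed.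

Lemma ybe_ractw u v w : ractw (ractw u v) w = ractw (ractw u (lactw v w)) (ractw v w).
Proof.
by rewrite -!ractw_catr; case: (actw_congr u (lactw_ractw_cong v w)).
Qed.

Lemma ybe_middlew u v w :
  ractw (lactw u v) (lactw (ractw u v) w) = lactw (ractw u (lactw v w)) (ractw v w).
Proof.
elim: u v w => [|x u IHu] v w; first by [].
rewrite -(cat1s x u) !(lactw_catl, ractw_catl).
(* Reduction to a one-letter first word; a second induction then reduces the middle word to one
   letter. *)
suff step v' w' : ractw (lactw [:: x] v') (lactw (ractw [:: x] v') w') =
    lactw (ractw [:: x] (lactw v' w')) (ractw v' w').
  by rewrite step ybe_lactw IHu.
elim: v' x w' {u IHu v w} => [|y v IHv] x w; first by rewrite lactw_nil.
rewrite -(cat1s y v) !(lactw_catl, lactw_catr, ractw_catl, ractw_catr).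
have step c w' : ractw (lactw [:: c] [:: y]) (lactw (ractw [:: c] [:: y]) w') =
    lactw (ractw [:: c] (lactw [:: y] w')) (ractw [:: y] w').
  by rewrite /=; have [_ -> _] := lletterw_letters c y w'.
(* After crossing [y], the letter [x] is still a single letter, so the hypothesis on [v] applies to
   it. *)
by rewrite -[ractw [:: x] [:: y]]/[:: rletter x y] IHv -step ybe_lactw -ybe_ractw.
Qed.

End WordActions.

(** * The inverse braiding *)

Lemma yang_baxter_inv (X : Type) (r s : X * X -> X * X) :
  cancel r s -> cancel s r -> yang_baxter r -> yang_baxter s.
Proof.
move=> rK sK ybe p.
have K12 a b : cancel a b -> cancel (@r12 X a) (r12 b).
  by move=> aK [[x y] z]; rewrite /r12 /= aK.
have K23 a b : cancel a b -> cancel (@r23 X a) (r23 b).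
  by move=> aK [[x y] z]; rewrite /r23 /= -surjective_pairing aK.
(* At this point the left side of the equation for [r] collapses to [p]; its right side, put for [p]
   in the right side of the goal, cancels there. *)
have := ybe ((r12 s \o r23 s \o r12 s) p); rewrite /= !(K12 _ _ sK, K23 _ _ sK).
by move=> {2}->; rewrite !(K12 _ _ rK, K23 _ _ rK).
Qed.

Lemma word_cong_inv (X : Type) (r s : X * X -> X * X) u v :
  cancel r s -> word_cong r u v -> word_cong s u v.
Proof.
move=> rK; elim=> {u v} [x y z t e|u|u v _ IH|u v w _ IHu _ IHv|u u' v v' _ IHu _ IHv].
- by apply/word_cong_sym/word_cong_rel; rewrite -e rK.
- exact: word_cong_refl.
- exact: word_cong_sym.
- exact: word_cong_trans IHu IHv.
- exact: word_cong_cat.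
Qed.

(** The crossings are undone in reverse order: [step] brings the first letter of [u] back, which
    leaves the configuration for the rest of [u]. *)
Lemma actwK (X : Type) (r s : X * X -> X * X) u v : cancel r s ->
  lactw s (lactw r u v) (ractw r u v) = u /\ ractw s (lactw r u v) (ractw r u v) = v.
Proof.
move=> rK.
have step x w : lactw s (lletterw r x w) [:: rletterw r x w] = [:: x] /\
    ractw s (lletterw r x w) [:: rletterw r x w] = w.
  elim: w x => //= y w IH x; have [-> ->] := IH (rletter r x y).
  by rewrite /= /lletter /rletter -surjective_pairing rK.
elim: u => [|x u [IHl IHr]] /=; first by rewrite lactw_nil ractw_nil.
rewrite -cat1s lactw_catr ractw_catr.
by have [-> ->] := step x (lactw r u v); rewrite IHl IHr.
Qed.

(** * Descent of the actions to the associated monoid *)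

Section MonoidActions.
Variables (X : Type) (r : X * X -> X * X).
Hypothesis ybe : yang_baxter r.

Definition assoc_lact (a u : assoc_monoid r) : assoc_monoid r :=
  word_class r (lactw r (word_repr a) (word_repr u)).
Definition assoc_ract (a u : assoc_monoid r) : assoc_monoid r :=
  word_class r (ractw r (word_repr a) (word_repr u)).

Lemma assoc_lact_class u v :
  assoc_lact (word_class r u) (word_class r v) = word_class r (lactw r u v).
Proof.
by apply/word_classP; apply: (actw_cong ybe _ _).1; exact: word_class_repr.
Qed.

Lemma assoc_ract_class u v :
  assoc_ract (word_class r u) (word_class r v) = word_class r (ractw r u v).
Proof.
by apply/word_classP; apply: (actw_cong ybe _ _).2; exact: word_class_repr.
Qed.

Lemma word_class1 : (1 : assoc_monoid r)%g = word_class r [::].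
Proof. by []. Qed.

Lemma word_classM u v :
  (word_class r u * word_class r v)%g = word_class r (u ++ v).
Proof. exact/esym/word_class_cat. Qed.

Lemma word_class_ind (P : assoc_monoid r -> Prop) :
  (forall w, P (word_class r w)) -> forall u, P u.
Proof. by move=> Pw u; rewrite -(word_reprK u). Qed.

Lemma assoc_M3 : M3_monoid assoc_lact assoc_ract.
Proof.
split; do ![elim/word_class_ind => ?].
- by rewrite word_class1 assoc_lact_class lactw_nil.
- by rewrite word_class1 assoc_lact_class.
- by rewrite word_class1 assoc_ract_class.
- by rewrite word_class1 assoc_ract_class ractw_nil.
- by rewrite word_classM !assoc_lact_class lactw_catl.
- by rewrite word_classM !assoc_ract_class ractw_catr.
- by rewrite assoc_ract_class word_classM !assoc_lact_class word_classM lactw_catr.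
- by rewrite assoc_lact_class word_classM !assoc_ract_class word_classM ractw_catl.
- rewrite assoc_lact_class assoc_ract_class !word_classM.
  exact/word_classP/word_cong_sym/lactw_ractw_cong.
Qed.

Lemma assoc_map_yang_baxter : yang_baxter (assoc_map assoc_lact assoc_ract).
Proof.
case=> [[]]; do 3![elim/word_class_ind => ?].
rewrite /r12 /r23 /assoc_map /= !(assoc_lact_class, assoc_ract_class).
by rewrite ybe_lactw // ybe_middlew // -ybe_ractw.
Qed.

Lemma assoc_map_bij : bijective r -> bijective (assoc_map assoc_lact assoc_ract).
Proof.
move=> [s rK sK]; have ybes := yang_baxter_inv rK sK ybe.
pose g (p : assoc_monoid r * assoc_monoid r) :=
  (word_class r (lactw s (word_repr p.1) (word_repr p.2)),
   word_class r (ractw s (word_repr p.1) (word_repr p.2))).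
have gE u v : g (word_class r u, word_class r v) =
    (word_class r (lactw s u v), word_class r (ractw s u v)).
  (* Independence of representatives is proved for the congruence of [s], where [s] being braided
     applies, and carried back to that of [r]. *)
  have c w := word_cong_inv rK (word_class_repr r w).
  have [cl cr] := actw_cong ybes (c u) (c v).
  congr pair; apply/word_classP.
  - exact: word_cong_inv sK cl.
  - exact: word_cong_inv sK cr.
exists g; case; elim/word_class_ind => u; elim/word_class_ind => v.
  rewrite /assoc_map /= assoc_lact_class assoc_ract_class gE.
  by have [-> ->] := actwK u v rK.
rewrite gE /assoc_map /= assoc_lact_class assoc_ract_class.
by have [-> ->] := actwK u v sK.
Qed.

Lemma assoc_graded_braided : bijective r ->
  graded_braided_monoid assoc_lact assoc_ract (@assoc_deg X r).
Proof.
move=> bij_r; split; last split; last split.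
- split; first exact: assoc_M3.
  by split; [exact: assoc_map_bij | exact: assoc_map_yang_baxter].
- exact: assoc_monoid_graded.
- by move=> a u; rewrite assoc_deg_class size_lactw.
- by move=> a u; rewrite assoc_deg_class size_ractw.
Qed.

Lemma assoc_map_gen x y :
  assoc_map assoc_lact assoc_ract (assoc_gen r x, assoc_gen r y) =
  (assoc_gen r (r (x, y)).1, assoc_gen r (r (x, y)).2).
Proof. by rewrite /assoc_map /= !(assoc_lact_class, assoc_ract_class). Qed.

End MonoidActions.

(** * Restriction to degree one, and the equivalence *)

Lemma yang_baxter_embed (X Y : Type) (r : X * X -> X * X) (R : Y * Y -> Y * Y)
    (g : X -> Y) :
  injective g -> (forall x y, R (g x, g y) = (g (r (x, y)).1, g (r (x, y)).2)) ->
  yang_baxter R -> yang_baxter r.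
Proof.
move=> g_inj Rg ybe [[x y] z]; have := ybe (g x, g y, g z).
rewrite /r12 /r23 /= !Rg /=.
case=> /g_inj e1 /g_inj e2 /g_inj e3.
(* On the left the first two letters are still an unsplit value of [r], whereas the equations are
   letterwise. *)
by rewrite [X in (X, _) = _]surjective_pairing e1 e2 e3.
Qed.

Theorem theorem3p23 (X : Type) (r : X * X -> X * X)
  (Hquad : quadratic_set r) (Hcanc : two_cancellative r) :
  (exists lact ract : assoc_monoid r -> assoc_monoid r -> assoc_monoid r,
      graded_braided_monoid lact ract (@assoc_deg X r) /\
      (forall x y : X,
         assoc_map lact ract (assoc_gen r x, assoc_gen r y) =
         (assoc_gen r (r (x, y)).1, assoc_gen r (r (x, y)).2))) <->
  braided_set r.
Proof.
split=> [[lact [ract [[[_ [_ ybe]] _] restr]]] | [_ ybe]].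
  by split=> //; exact: yang_baxter_embed (@assoc_gen_inj X r) restr ybe.
exists (assoc_lact (r := r)), (assoc_ract (r := r)).
by split; [exact: assoc_graded_braided Hquad.2 | exact: assoc_map_gen].
Qed.
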